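(* Let $m>1$ be an integer and let $l^*$ denote the adjoint of the left normed Lie bracketing over $\mathbb{Z}$ (an endomorphism of $\mathbb{Z}\langle A\rangle$). (i) The complement in $A^*$ of the support of the free Lie algebra $\mathcal{L}_{\mathbb{Z}_m}(A)$ consists exactly of the words $w$ with $m\mid c(w)$; equivalently, of the words $w$ such that $l^*(w)\in m\,\mathbb{Z}\langle A\rangle$ (i.e. every coefficient of $l^*(w)$ is divisible by $m$). (ii) Two words $u,v$ form a twin (respectively anti-twin) pair with respect to $\mathcal{L}_{\mathbb{Z}_m}(A)$ if and only if $l^*(u)-l^*(v)$ (respectively $l^*(u)+l^*(v)$) lies in $m\,\mathbb{Z}\langle A\rangle$.
   Context: $A$ is a finite alphabet, $A^*$ the free monoid of words on $A$, $\epsilon$ the empty word. For a commutative ring $K$ with unity, $K\langle A\rangle$ is the free associative algebra on $A$ (non-commutative polynomials), each $P$ written $P=\sum_{w\in A^*}(P,w)w$. With the bracket $[P,Q]=PQ-QP$, the free Lie algebra $\mathcal{L}_K(A)$ is the Lie subalgebra of $K\langle A\rangle$ generated by $A$; its elements are Lie polynomials. $\mathbb{Z}_m=\mathbb{Z}/m\mathbb{Z}$. The scalar product on $K\langle A\rangle$ is $(P,Q)=\sum_w (P,w)(Q,w)$. The left normed Lie bracketing $l$ is defined by $l(\epsilon)=0$, $l(a)=a$, $l(ua)=[l(u),a]$ ($a\in A$, $u\in A^+$), extended $K$-linearly; its adjoint $l^*$ is the $K$-linear endomorphism of $K\langle A\rangle$ with $(l^*(u),v)=(l(v),u)$ for all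 words $u,v$ (equivalently $l^*(\epsilon)=0$, $l^*(a)=a$, $l^*(aub)=l^*(au)b-l^*(ub)a$ for $a,b\in A$, $u\in A^*$). The support of $\mathcal{L}_K(A)$ is the set of words $w$ with $(P,w)\neq 0$ for some $P\in\mathcal{L}_K(A)$. A pair of words $u,v$ is twin (resp. anti-twin) with respect to $\mathcal{L}_K(A)$ if $(Q,u)=(Q,v)$ (resp. $(Q,u)=-(Q,v)$) for every $Q\in\mathcal{L}_K(A)$. For a word $w$, $c(w)$ is the non-negative generator of the ideal $\{(P,w): P\in\mathcal{L}_{\mathbb{Z}}(A)\}$ of $\mathbb{Z}$. *)

(* Defs.v *)
From Stdlib Require Import Classical ClassicalEpsilon.
From HB Require Import structures.
From mathcomp Require Import all_boot all_order all_algebra finmap.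
From mathcomp Require Export monalg.

Set Implicit Arguments.
Unset Strict Implicit.
Unset Printing Implicit Defensive.

Import Order.TTheory GRing.Theory Num.Theory.
Local Open Scope ring_scope.

(* The monoid algebra of the free monoid: << w >> is the word w seen as a
   polynomial and P@_w is the coefficient (P, w). *)
Notation "{ 'ncpoly' K [ A ] }" := {malg K[{fmonom A}]}
  (at level 0, K, A at level 2, format "{ 'ncpoly'  K [ A ] }") : type_scope.

Section FreeLie.
Variables (A : finType) (K : comNzRingType).
Implicit Types (P Q : {ncpoly K[A]}) (u v w : {fmonom A}) (a b : A).

Definition letter a : {ncpoly K[A]} := << FMonom [:: a] >>.

Definition bracket P Q : {ncpoly K[A]} := P * Q - Q * P.

Inductive free_lie : {ncpoly K[A]} -> Prop :=
| free_lie_letter a : free_lie (letter a)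
| free_lie0 : free_lie 0
| free_lieD P Q : free_lie P -> free_lie Q -> free_lie (P + Q)
| free_lieZ (k : K) P : free_lie P -> free_lie (k *: P)
| free_lie_bracket P Q : free_lie P -> free_lie Q -> free_lie (bracket P Q).

Definition lie_support w : Prop := exists2 P, free_lie P & P@_w != 0.

Definition twin u v : Prop := forall Q, free_lie Q -> Q@_u = Q@_v.

Definition antitwin u v : Prop := forall Q, free_lie Q -> Q@_u = - Q@_v.

Definition dotp P Q : K := \sum_(w <- msupp P) P@_w * Q@_w.

Definition linext (f : {fmonom A} -> {ncpoly K[A]}) P : {ncpoly K[A]} :=
  \sum_(w <- msupp P) P@_w *: f w.

Definition lnb_word w : {ncpoly K[A]} :=
  if fmonom_val w is a :: s
  then foldl (fun P b => bracket P (letter b)) (letter a) s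
  else 0.

Definition lnb : {ncpoly K[A]} -> {ncpoly K[A]} := linext lnb_word.

(* Writing l for lnb, the left normed bracketing, and l^* for its adjoint lnb_adj:
   since l(v) is homogeneous of degree |v|, l^*(u) is the sum of (l(v), u) v
   over the words v with |v| = |u|; see lnb_adjP. *)
Definition lnb_adj_word u : {ncpoly K[A]} :=
  \sum_(v : (size u).-tuple A) << (lnb_word (FMonom v))@_u *g FMonom v >>.

Definition lnb_adj : {ncpoly K[A]} -> {ncpoly K[A]} := linext lnb_adj_word.

Lemma linextEw (d : {fset {fmonom A}}) f P : (msupp P `<=` d)%fset ->
  linext f P = \sum_(w <- d) P@_w *: f w.
Proof.
move=> le; rewrite /linext (big_fset_incl _ le) => //= x xd /mcoeff_outdom ->.
by rewrite scale0r.
Qed.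

Fact linext_is_linear f : linear (linext f).
Proof.
move=> k P Q; set d := (msupp (k *: P + Q) `|` (msupp P `|` msupp Q))%fset.
rewrite !(@linextEw d) ?scaler_sumr -?big_split.
- by apply: eq_bigr => w _; rewrite mcoeffD mcoeffZ scalerDl scalerA.
- by rewrite /d fsetUCA fsetUA fsubsetUr.
- by rewrite /d fsetUCA fsubsetUl.
- by rewrite /d fsubsetUl.
Qed.

HB.instance Definition _ f :=
  GRing.isLinear.Build K {ncpoly K[A]} {ncpoly K[A]} *:%R (linext f)
    (linext_is_linear f).
HB.instance Definition _ := GRing.Linear.copy lnb (linext lnb_word).
HB.instance Definition _ := GRing.Linear.copy lnb_adj (linext lnb_adj_word).

Lemma linextU f w : linext f << w >> = f w.
Proof. by rewrite /linext msuppU1 big_seq_fset1 mcoeffUU scale1r. Qed.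

Lemma lnb_nil : lnb << FMonom [::] >> = 0.
Proof. by rewrite /lnb linextU. Qed.

Lemma lnb_letter a : lnb (letter a) = letter a.
Proof. by rewrite /lnb linextU. Qed.

Lemma lnb_rcons (s : seq A) a : s != [::] ->
  lnb << FMonom (rcons s a) >> = bracket (lnb << FMonom s >>) (letter a).
Proof.
by case: s => // b s _; rewrite /lnb !linextU /lnb_word /= -cats1 foldl_cat.
Qed.

Lemma dotpU P w : dotp P << w >> = P@_w.
Proof.
rewrite {2}[P]monalgE raddf_sum /=; apply: eq_bigr => v _.
by rewrite mcoeffU1 mcoeffU eq_sym mulr_natr; case: eqP => [->|].
Qed.

Lemma lnb_word_homog u v : (lnb_word v)@_u != 0 -> size u = size v.
Proof.
have hM (n p : nat) P Q :
    (forall w, P@_w != 0 -> size w = n) -> (forall w, Q@_w != 0 -> size w = p) ->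
    forall w, (P * Q)@_w != 0 -> size w = (n + p)%N.
  move=> hP hQ w; rewrite mcoeffMl; apply: contraNeq => ne.
  rewrite big_seq big1 // => w1; rewrite -mcoeff_neq0 => /hP s1.
  rewrite big_seq big1 // => w2; rewrite -mcoeff_neq0 => /hQ s2.
  case: eqP => // e; case/eqP: ne.
  by rewrite -e fmM size_cat s1 s2.
have hL a w : (letter a)@_w != 0 -> size w = 1%N.
  by rewrite mcoeffU1; case: (_ =P w) => [<- //|_]; rewrite eqxx.
rewrite /lnb_word; case: v => [] [|a s] /=; first by rewrite mcoeff0 => /eqP.
have: forall w, (letter a)@_w != 0 -> size w = 1%N by apply: hL.
rewrite -[(size s).+1]add1n.
elim: s (letter a) 1%N => [|b s IH] P n hP /=; first by rewrite addn0; apply: hP.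
rewrite addnS -addSn; apply: IH => w; rewrite mcoeffB.
have [e|ne] := eqVneq (P * letter b)@_w 0; last first.
  by move=> _; rewrite -addn1; apply: hM hP (hL b) _ ne.
by rewrite e sub0r oppr_eq0 => ne; rewrite -add1n; apply: hM (hL b) hP _ ne.
Qed.

Lemma lnb_adjP u v : dotp (lnb_adj << u >>) << v >> = dotp (lnb << v >>) << u >>.
Proof.
rewrite !dotpU /lnb_adj /lnb !linextU /lnb_adj_word raddf_sum /=.
have [e|ne] := eqVneq (size v) (size u).
  have ev : size (fmonom_val v) == size (fmonom_val u) by apply/eqP.
  rewrite (bigD1 (Tuple ev)) //= big1 ?addr0.
    by rewrite !fmK mcoeffUU.
  move=> t nt; rewrite mcoeffU; case: eqP => // et; case/eqP: nt.
  by apply: val_inj; rewrite /= -et.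
have -> : (lnb_word v)@_u = 0.
  by apply/eqP; apply: contraNT ne => /lnb_word_homog ->.
apply: big1 => t _; rewrite mcoeffU; case: eqP => // et.
by case/eqP: ne; rewrite -et /= size_tuple.
Qed.

End FreeLie.

Arguments letter {A} K a.
Arguments free_lie {A K} P.
Arguments lie_support {A} K w.
Arguments twin {A} K u v.
Arguments antitwin {A} K u v.

Definition is_lie_coef_gen (A : finType) (w : {fmonom A}) (c : nat) : Prop :=
  forall z : int,
    (exists2 P : {ncpoly int[A]}, free_lie P & P@_w = z) <-> (c%:Z %| z)%Z.

(* The non-negative generator c(w); its existence and uniqueness are proved below. *)
Definition lie_coef_gen (A : finType) (w : {fmonom A}) : nat :=
  epsilon (inhabits 0%N) (is_lie_coef_gen w).

Lemma is_lie_coef_gen_uniq (A : finType) (w : {fmonom A}) c d :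
  is_lie_coef_gen w c -> is_lie_coef_gen w d -> c = d.
Proof.
move=> hc hd; apply/eqP; rewrite eqn_dvd; apply/andP; split.
  exact: ((hc d%:Z).1 ((hd d%:Z).2 (dvdzz _))).
exact: ((hd c%:Z).1 ((hc c%:Z).2 (dvdzz _))).
Qed.

Lemma int_ideal_principal (I : int -> Prop) :
    I 0 -> (forall x y, I x -> I y -> I (x + y)) ->
    (forall k x, I x -> I (k * x)) ->
  exists c : nat, forall z : int, I z <-> (c%:Z %| z)%Z.
Proof.
move=> I0 ID IM.
case: (classic (exists n : nat, I n.+1%:Z)) => [|no]; last first.
  exists 0%N => z; rewrite dvd0z; split=> [Iz|/eqP -> //].
  apply/negP => /negP nz; apply: no; exists `|z|%N.-1.
  rewrite prednK ?absz_gt0 //.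
  rewrite abszE; have [ge|lt] := lerP 0 z; first by rewrite ger0_norm.
  by rewrite ltr0_norm // -mulN1r; apply: IM.
case=> n; elim/ltn_ind: n => n IH In.
case: (classic (exists2 k, (k < n)%N & I k.+1%:Z)) => [[k lt Ik]|min].
  exact: IH lt Ik.
exists n.+1 => z; split=> [Iz|/dvdzP[q ->]]; last exact: IM.
have Ir : I (modz z n.+1) by rewrite /modz -mulNr; apply: ID => //; apply: IM.
have ge := modz_ge0 z (isT : n.+1%:Z != 0).
have lt := ltz_pmod z (isT : 0 < n.+1%:Z).
apply/dvdz_mod0P/eqP/negPn/negP => nz; case: min; exists `|modz z n.+1|%N.-1.
  by rewrite -ltnS prednK ?absz_gt0 // -ltz_nat gez0_abs.
by rewrite prednK ?absz_gt0 // gez0_abs.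
Qed.

Lemma lie_coef_genP (A : finType) (w : {fmonom A}) :
  is_lie_coef_gen w (lie_coef_gen w).
Proof.
apply: epsilon_spec; apply: int_ideal_principal.
- by exists 0; [exact: free_lie0|rewrite mcoeff0].
- move=> _ _ [P hP <-] [Q hQ <-].
  by exists (P + Q); [exact: free_lieD|rewrite mcoeffD].
- by move=> k _ [P hP <-]; exists (k *: P); [exact: free_lieZ|rewrite mcoeffZ].
Qed.

Definition in_multiples (A : finType) (m : nat) (P : {ncpoly int[A]}) : Prop :=
  exists Q : {ncpoly int[A]}, P = Q *+ m.

Lemma in_multiplesP (A : finType) (m : nat) (P : {ncpoly int[A]}) :
  in_multiples m P <-> forall w, (m%:Z %| P@_w)%Z.
Proof.
split=> [[Q ->] w|h]; first by rewrite mcoeffMn -mulr_natr natz dvdz_mull.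
exists (\sum_(w <- msupp P) << (P@_w %/ m)%Z *g w >>).
rewrite {1}[P]monalgE -sumrMnl; apply: eq_bigr => w _.
by rewrite -monalgUMn -mulr_natr natz divzK.
Qed.

(* Main.v *)
(* Every Lie polynomial over K is a K-linear combination of left normed brackets
   l(v): by the Jacobi identity [P, [Q, a]] = [[P, Q], a] - [[P, a], Q], bracketing
   with l(v) reduces, by induction on v, to bracketing with letters. Hence a linear
   relation between two coefficients holds on all of the free Lie algebra as soon as
   it holds on the l(v). These have coefficients coming from Z, so over Z_m the
   relation becomes a divisibility by m of the numbers (l(v), u), which are the
   coefficients of l^*(u). *)
Require Import Defs.
From mathcomp Require Import all_boot all_algebra finmap.

Local Open Scope ring_scope.
Import GRing.Theory.

Section LieImage.
Variables (A : finType) (K : comNzRingType).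
Implicit Types (P Q R : {ncpoly K[A]}) (s : seq A) (u v w : {fmonom A}).

(* The library makes malg an algebra only for commutative monoids. *)
Lemma ncpoly_scalerAr (k : K) P Q : P * (k *: Q) = k *: (P * Q).
Proof.
apply/malgP => w; rewrite mcoeffZ.
rewrite [LHS](mcoeffMlw w (fsubset_refl _) (msuppZ_le k Q)) mcoeffMl mulr_sumr.
apply: eq_bigr => x _; rewrite mulr_sumr; apply: eq_bigr => y _.
by rewrite mcoeffZ mulrnAr mulrCA.
Qed.

Lemma bracket_suml (I : Type) (r : seq I) (F : I -> {ncpoly K[A]}) P :
  bracket (\sum_(i <- r) F i) P = \sum_(i <- r) bracket (F i) P.
Proof. by rewrite /bracket mulr_suml mulr_sumr sumrB. Qed.

Lemma bracket_sumr (I : Type) (r : seq I) (F : I -> {ncpoly K[A]}) P :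
  bracket P (\sum_(i <- r) F i) = \sum_(i <- r) bracket P (F i).
Proof. by rewrite /bracket mulr_suml mulr_sumr sumrB. Qed.

Lemma bracketZl (k : K) P Q : bracket (k *: P) Q = k *: bracket P Q.
Proof. by rewrite /bracket ncpoly_scalerAr -scalerAl scalerBr. Qed.

Lemma bracketZr (k : K) P Q : bracket P (k *: Q) = k *: bracket P Q.
Proof. by rewrite /bracket ncpoly_scalerAr -scalerAl scalerBr. Qed.

Lemma bracket_jacobi P Q R :
  bracket P (bracket Q R) = bracket (bracket P Q) R - bracket (bracket P R) Q.
Proof.
(* After expansion both sides are signed sums of monomials in x, y, z; here e and f stand for yxz
   and zxy, which cancel on the right. *)
have cancel (V : zmodType) (a b c d e f : V) :
    a - b - (c - d) = a - e - (f - d) - (b - f - (e - c)).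
  by rewrite !opprB [RHS]addrACA !subrKA addrACA [RHS]addrACA [- b - c]addrC.
have jacobi (T : pzRingType) (x y z : T) :
    x * (y * z - z * y) - (y * z - z * y) * x =
    (x * y - y * x) * z - z * (x * y - y * x)
      - ((x * z - z * x) * y - y * (x * z - z * x)).
  by rewrite !(mulrBr, mulrBl) !mulrA; exact: cancel.
exact: jacobi.
Qed.

Lemma lnb_word_rcons s a : s != [::] ->
  lnb_word K (FMonom (rcons s a)) = bracket (lnb_word K (FMonom s)) (letter K a).
Proof. by move=> s0; have := lnb_rcons K a s0; rewrite /lnb !linextU. Qed.

Definition lnb_image P : Prop := exists Q, P = lnb Q.

Lemma lnb_image_word v : lnb_image (lnb_word K v).
Proof. by exists << v >>; rewrite /lnb linextU. Qed.

Lemma lnb_image0 : lnb_image 0.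
Proof. by exists 0; rewrite raddf0. Qed.

Lemma lnb_imageD P Q : lnb_image P -> lnb_image Q -> lnb_image (P + Q).
Proof. by move=> [P' ->] [Q' ->]; exists (P' + Q'); rewrite raddfD. Qed.

Lemma lnb_imageZ (k : K) P : lnb_image P -> lnb_image (k *: P).
Proof. by move=> [P' ->]; exists (k *: P'); rewrite linearZ. Qed.

Lemma lnb_imageB P Q : lnb_image P -> lnb_image Q -> lnb_image (P - Q).
Proof. by move=> [P' ->] [Q' ->]; exists (P' - Q'); rewrite raddfB. Qed.

Lemma lnb_image_sum (I : Type) (r : seq I) (F : I -> {ncpoly K[A]}) :
  (forall i, lnb_image (F i)) -> lnb_image (\sum_(i <- r) F i).
Proof.
by move=> hF; apply: big_ind => //; [exact: lnb_image0 | exact: lnb_imageD].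
Qed.

(** Appending a letter to a nonempty word s turns l(s) into [l(s), a]; the empty word contributes
    zero because l kills it. *)
Lemma lnb_image_bracket_letter P a :
  lnb_image P -> lnb_image (bracket P (letter K a)).
Proof.
move=> [Q ->]; rewrite /lnb /linext bracket_suml; apply: lnb_image_sum => -[s].
rewrite bracketZl; apply: lnb_imageZ.
have [->|s0] := eqVneq s [::].
  by rewrite /bracket mul0r mulr0 subrr; exact: lnb_image0.
by rewrite -lnb_word_rcons //; exact: lnb_image_word.
Qed.

Lemma lnb_image_bracket_word P v :
  lnb_image P -> lnb_image (bracket P (lnb_word K v)).
Proof.
(* [P] stays general: the second Jacobi term needs the induction hypothesis at
   [bracket P (letter K a)]. *)
case: v => s; elim/last_ind: s P => [|s a IH] P hP.
  by rewrite /bracket mul0r mulr0 subrr; exact: lnb_image0.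
have [->|s0] := eqVneq s [::]; first exact: lnb_image_bracket_letter.
rewrite lnb_word_rcons // bracket_jacobi; apply: lnb_imageB.
  by apply: lnb_image_bracket_letter; exact: IH.
by apply: IH; exact: lnb_image_bracket_letter.
Qed.

Lemma free_lie_lnb_image P : free_lie P -> lnb_image P.
Proof.
elim=> [a||{}P Q _ hP _ hQ|k {}P _ hP|{}P Q _ hP _ [Q' ->]].
- exact: lnb_image_word (FMonom [:: a]).
- exact: lnb_image0.
- exact: lnb_imageD.
- exact: lnb_imageZ.
(* Only the right factor is expanded into left normed brackets; the left one remains an arbitrary
   element of the image. *)
rewrite /lnb /linext bracket_sumr; apply: lnb_image_sum => w.
by rewrite bracketZr; apply: lnb_imageZ; exact: lnb_image_bracket_word.
Qed.

Lemma free_lie_lnb_word v : free_lie (lnb_word K v).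
Proof.
case: v => s; elim/last_ind: s => [|s a IH]; first exact: free_lie0.
have [->|s0] := eqVneq s [::]; first exact: free_lie_letter.
by rewrite lnb_word_rcons //; apply: free_lie_bracket => //; exact: free_lie_letter.
Qed.

(** The l(v) are Lie polynomials and span all the others. [S] serves both for linear relations
    between coefficients and, over the integers, for divisibility of a coefficient. *)
Lemma free_lie_span (S : {ncpoly K[A]} -> Prop) :
    S 0 -> (forall P Q, S P -> S Q -> S (P + Q)) ->
    (forall k P, S P -> S (k *: P)) ->
  (forall P, free_lie P -> S P) <-> (forall v, S (lnb_word K v)).
Proof.
move=> S0 SD SZ; split=> [hS v|hS P /free_lie_lnb_image[Q ->]].
  by apply: hS; exact: free_lie_lnb_word.
by apply: big_ind => // w _; exact: SZ.
Qed.

Lemma free_lie_coef_relation u v (k : K) :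
  (forall P, free_lie P -> P@_u + k * P@_v = 0) <->
  (forall w, (lnb_word K w)@_u + k * (lnb_word K w)@_v = 0).
Proof.
apply: (free_lie_span (fun P => P@_u + k * P@_v = 0)).
- by rewrite !mcoeff0 mulr0 addr0.
- by move=> P Q hP hQ; rewrite !mcoeffD mulrDr addrACA hP hQ addr0.
- by move=> c P hP; rewrite !mcoeffZ mulrCA -mulrDr hP mulr0.
Qed.

Lemma mcoeff_lnb_adj u v : (lnb_adj << u >>)@_v = (lnb_word K v)@_u.
Proof. by rewrite -dotpU lnb_adjP dotpU /lnb linextU. Qed.

End LieImage.

Section BaseChange.
Variables (A : finType) (K L : comNzRingType) (f : {rmorphism K -> L}).

Lemma mcoeffM_rmorph (P Q : {ncpoly K[A]}) (P' Q' : {ncpoly L[A]}) :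
    (forall w, P'@_w = f P@_w) -> (forall w, Q'@_w = f Q@_w) ->
  forall w, (P' * Q')@_w = f (P * Q)@_w.
Proof.
(* [f] may kill coefficients and shrink supports; this inclusion lets both products be expanded over
   the supports of [P] and [Q]. *)
have sub (R : {ncpoly K[A]}) (R' : {ncpoly L[A]}) :
    (forall w, R'@_w = f R@_w) -> fsubset (msupp R') (msupp R).
  move=> h; apply/fsubsetP => w; rewrite -!mcoeff_neq0 h.
  by apply: contra_neq => ->; rewrite rmorph0.
move=> hP hQ w; rewrite (mcoeffMlw w (sub _ _ hP) (sub _ _ hQ)) mcoeffMl.
rewrite rmorph_sum; apply: eq_bigr => x _; rewrite rmorph_sum.
by apply: eq_bigr => y _; rewrite rmorphMn rmorphM hP hQ.
Qed.

(** l(v) is built from letters by products and differences, and applying [f] to coefficients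
    respects both. *)
Lemma mcoeff_lnb_word_rmorph (v w : {fmonom A}) :
  (lnb_word L v)@_w = f (lnb_word K v)@_w.
Proof.
have letterE (a : A) (x : {fmonom A}) : (letter L a)@_x = f (letter K a)@_x :> L.
  by rewrite !mcoeffU1 rmorph_nat.
case: v => s; elim/last_ind: s w => [|s a IH] w; first by rewrite !mcoeff0 rmorph0.
have [->|s0] := eqVneq s [::]; first exact: letterE.
rewrite !lnb_word_rcons // !mcoeffB rmorphB.
by congr (_ - _); exact: mcoeffM_rmorph.
Qed.

End BaseChange.

Lemma intr_Zp_eq0 (m : nat) (z : int) : (1 < m)%N ->
  (z%:~R == 0 :> 'Z_m) = (m%:Z %| z)%Z.
Proof.
move=> m1.
have natE (n : nat) : (n%:R == 0 :> 'Z_m) = (m %| n)%N.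
  (* The modulus of ['Z_m] is really m because 1 < m, which is what [Zp_cast] uses. *)
  by rewrite Zp_nat -val_eqE /= Zp_cast // /dvdn.
case: z => n; first exact: natE.
by rewrite NegzE mulrNz oppr_eq0 natE dvdzE abszN.
Qed.

(* Over Z_m, the case k = 0 describes the support, and k = -1, 1 twins and anti-twins. *)
Lemma Zp_coef_relation (A : finType) (m : nat) (u v : {fmonom A}) (k : int) :
    (1 < m)%N ->
  (forall P : {ncpoly 'Z_m[A]}, free_lie P -> P@_u + k%:~R * P@_v = 0) <->
  in_multiples m (lnb_adj (<< u >> : {ncpoly int[A]}) + k *: lnb_adj << v >>).
Proof.
move=> m1; rewrite free_lie_coef_relation in_multiplesP.
have E w : ((lnb_word 'Z_m w)@_u + k%:~R * (lnb_word 'Z_m w)@_v == 0) =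
    (m %| (lnb_adj (<< u >> : {ncpoly int[A]}) + k *: lnb_adj << v >>)@_w)%Z.
  have -> : (lnb_adj (<< u >> : {ncpoly int[A]}) + k *: lnb_adj << v >>)@_w =
      (lnb_word int w)@_u + k * (lnb_word int w)@_v.
    rewrite mcoeffD mcoeffZ.
    by congr (_ + _ * _); exact: mcoeff_lnb_adj.
  rewrite -intr_Zp_eq0 // rmorphD rmorphM.
  have coefE := mcoeff_lnb_word_rmorph _ _ _ (intmul 1 : {rmorphism int -> 'Z_m}).
  by rewrite (coefE _ w u) (coefE _ w v).
by split=> h w; [rewrite -E; apply/eqP | apply/eqP; rewrite E].
Qed.

Lemma not_lie_supportP (A : finType) (K : comNzRingType) (w : {fmonom A}) :
  ~ lie_support K w <-> forall P : {ncpoly K[A]}, free_lie P -> P@_w = 0.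
Proof.
split=> [h P hP|h [P /h ->]]; last by rewrite eqxx.
by apply/eqP/negPn/negP => nz; apply: h; exists P.
Qed.

(** Both sides say that m divides (P, w) for every integral Lie polynomial P, a condition that can
    be tested on the l(v). *)
Lemma dvdn_lie_coef_gen (A : finType) (m : nat) (w : {fmonom A}) :
  (m %| lie_coef_gen w)%N <->
  in_multiples m (lnb_adj (<< w >> : {ncpoly int[A]})).
Proof.
have span := @free_lie_span A int (fun P => m %| P@_w)%Z.
rewrite in_multiplesP; transitivity
  (forall P : {ncpoly int[A]}, free_lie P -> (m %| P@_w)%Z).
  split=> [md P hP|h].
    apply: (@dvdz_trans (lie_coef_gen w)); first exact: md.
    by apply/(lie_coef_genP w); exists P.
  (* The generator c(w) is itself a coefficient (P, w). *)
  have [P hP e] := (lie_coef_genP w (lie_coef_gen w)).2 (dvdzz _).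
  by have := h P hP; rewrite e.
rewrite span => [|||k P hP]; last by rewrite mcoeffZ dvdz_mull.
- by split=> h v; have := h v; rewrite mcoeff_lnb_adj.
- by rewrite mcoeff0 dvdz0.
- by move=> P Q hP hQ; rewrite mcoeffD rpredD.
Qed.

Theorem theorem2p6 (A : finType) (m : nat) (hm : (1 < m)%N) :
  (forall w : {fmonom A},
     (~ lie_support 'Z_m w <-> (m %| lie_coef_gen w)%N) /\
     (~ lie_support 'Z_m w <-> in_multiples m (lnb_adj (<< w >> : {ncpoly int[A]})))) /\
  (forall u v : {fmonom A},
     (twin 'Z_m u v <->
        in_multiples m (lnb_adj (<< u >> : {ncpoly int[A]}) - lnb_adj << v >>)) /\
     (antitwin 'Z_m u v <->
        in_multiples m (lnb_adj (<< u >> : {ncpoly int[A]}) + lnb_adj << v >>))).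
Proof.
split=> [w|u v]; last split.
- have suppE : ~ lie_support 'Z_m w <->
      in_multiples m (lnb_adj (<< w >> : {ncpoly int[A]})).
    (* With k = 0 the second word is a dummy, taken to be [w] again. *)
    have := Zp_coef_relation A m w w 0 hm; rewrite scale0r addr0 not_lie_supportP => <-.
    by split=> h P /h; rewrite mul0r addr0.
  by split; rewrite ?dvdn_lie_coef_gen.
- have := Zp_coef_relation A m u v (-1) hm; rewrite scaleN1r => <-.
  split=> h P /h; rewrite mulN1r; first by move=> ->; rewrite subrr.
  by move/eqP; rewrite subr_eq0 => /eqP.
- have := Zp_coef_relation A m u v 1 hm; rewrite scale1r => <-.
  split=> h P /h; rewrite mul1r; first by move=> ->; rewrite addNr.
  by move/eqP; rewrite addr_eq0 => /eqP.
Qed.
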